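(* Let $(X,f_{1,\infty})$ be a non-autonomous discrete dynamical system where $f_m\circ f_n=f_n\circ f_m$ for all $m,n\in\mathbb{N}$. If $(X,f_{1,\infty})$ is topologically mixing, then $(X,g_{1,\infty})$ is topologically mixing for every finite rearrangement $g_{1,\infty}$ of $f_{1,\infty}$.
   Context: $\mathbb{N}=\{1,2,3,\dots\}$. A non-autonomous discrete dynamical system (NDDS) is a pair $(X,f_{1,\infty})$ where $X$ is a compact metric space and $f_{1,\infty}=(f_n)_{n\in\mathbb{N}}$ is a sequence of continuous maps $f_n:X\to X$; $f_1^n:=f_n\circ\cdots\circ f_1$. The system is topologically mixing if for every pair of nonempty open sets $U,V\subset X$ there exists $k\in\mathbb{N}$ with $f_1^n(U)\cap V\neq\emptyset$ for all $n\geq k$. A sequence $g_{1,\infty}=(g_n)_{n\in\mathbb{N}}$ is a finite rearrangement of $f_{1,\infty}$ if there exists $N\in\mathbb{N}$ such that $(g_1,\dots,g_N)$ is a permutation of $(f_1,\dots,f_N)$ and $g_i=f_i$ for all $i\geq N+1$. *)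

(* Defs.v *)
From mathcomp Require Import all_boot all_fingroup all_algebra.
From mathcomp Require Import all_classical all_reals.
From mathcomp Require Import topology.

Set Implicit Arguments.
Unset Strict Implicit.
Unset Printing Implicit Defensive.

Local Open Scope classical_set_scope.

(* A sequence $f_{1,\infty} = (f_n)_{n \ge 1}$ of self-maps of X is encoded as
   f : nat -> X -> X with the index shifted by one: f i stands for f_{i+1}. *)

(* f_1^n = f_n \o ... \o f_1 *)
Fixpoint seq_comp (X : Type) (f : nat -> X -> X) (n : nat) : X -> X :=
  if n is m.+1 then f m \o seq_comp f m else idfun.

Definition topologically_mixing (X : topologicalType) (f : nat -> X -> X) :=
  forall U V : set X, open U -> U !=set0 -> open V -> V !=set0 ->
    exists k : nat, (0 < k)%N /\
      forall n : nat, (k <= n)%N -> (seq_comp f n @` U) `&` V !=set0.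

(* The permutation acts on positions, so repeated maps need no special care. *)
Definition finite_rearrangement (X : Type) (f g : nat -> X -> X) :=
  exists N : nat, (0 < N)%N /\
    (exists s : 'S_N, forall i : 'I_N, g i = f (s i)) /\
    (forall i : nat, (N <= i)%N -> g i = f i).

(* Main.v *)
(* The two products f_n \o ... \o f_1 and g_n \o ... \o g_1 have the same
   commuting factors up to order as soon as n >= N, so they coincide there;
   mixing only depends on the large n. *)
Require Import Defs.
From mathcomp Require Import all_boot all_fingroup all_algebra.
From mathcomp Require Import all_classical all_reals.
From mathcomp Require Import topology.

Local Open Scope classical_set_scope.

(** A composite of pairwise commuting maps depends only on the multiset of its factors. The first
    [N] factors of [g] are those of [f] permuted, so the composites agree at length [N], and beyond
    it both gain the same factors. Equal composites from [N] on transfer the mixing condition. *)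

Lemma foldr_comm_perm (I : eqType) (X : Type) (f : I -> X -> X) (x : X)
    (s t : seq I) :
  (forall i j, f i \o f j = f j \o f i) ->
  perm_eq s t -> foldr f x s = foldr f x t.
Proof.
move=> fC.
have fCs i u y : f i (foldr f y u) = foldr f (f i y) u.
  elim: u => //= j u IHu; rewrite -IHu.
  exact: (congr1 (@^~ (foldr f y u)) (fC i j)).
(* Swaps of two leading blocks generate all permutations of a list, so only these need checking. *)
move=> /catCA_perm_subst; apply=> {s t} u v w; rewrite !foldr_cat.
by elim: u => //= i u ->; rewrite fCs.
Qed.

(** The list is reversed because [foldr] applies its head last, as [seq_comp] does with the largest
    index. *)
Lemma seq_compE (X : Type) (f : nat -> X -> X) (n : nat) (x : X) :
  seq_comp f n x = foldr f x (rev (iota 0 n)).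
Proof. by elim: n => // n IHn; rewrite -[in RHS]addn1 iotaD rev_cat /= IHn. Qed.

Lemma seq_comp_perm (X : Type) (f g : nat -> X -> X) (N : nat) (s : 'S_N) :
  (forall m n, f m \o f n = f n \o f m) ->
  (forall i : 'I_N, g i = f (s i)) ->
  seq_comp g N =1 seq_comp f N.
Proof.
move=> fC gE x; rewrite !seq_compE -val_enum_ord -map_rev.
(* Moving [s] from the maps to the indices leaves two index lists to compare under the single family
   [f]. *)
have -> : foldr g x (map val (rev (enum 'I_N)))
        = foldr f x (map (val \o s) (rev (enum 'I_N))).
  by elim: (rev _) => //= i u ->; rewrite gE.
apply: foldr_comm_perm => //; rewrite map_comp; apply: perm_map.
rewrite map_rev perm_rev perm_sym perm_rev; apply: uniq_perm.
- exact: enum_uniq.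
- by rewrite map_inj_uniq ?enum_uniq//; exact: perm_inj.
- move=> i; rewrite mem_enum; apply/esym/mapP.
  by exists (s^-1%g i); rewrite ?mem_enum ?permKV.
Qed.

Lemma seq_comp_rearrangement (X : Type) (f g : nat -> X -> X) :
  (forall m n, f m \o f n = f n \o f m) ->
  finite_rearrangement f g ->
  exists N, forall n, (N <= n)%N -> seq_comp g n = seq_comp f n.
Proof.
move=> fC [N [_ [[s gE] gtail]]]; exists N; elim=> [|n IHn].
  rewrite leqn0 => /eqP N0; subst N => //.
(* At length exactly [N] the permutation is used; past it, the new outermost factor [g n] is
   [f n]. *)
rewrite leq_eqVlt => /predU1P[<-|leNn]; first exact/funext/(seq_comp_perm _ _ _ _ _ fC gE).
by rewrite /= gtail// IHn.
Qed.

Theorem proposition3p4 (R : realType) (X : metricType R)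
    (hX : compact [set: X])
    (f : nat -> X -> X) (hf : forall n : nat, continuous (f n))
    (hcomm : forall m n : nat, f m \o f n = f n \o f m)
    (hmix : topologically_mixing f)
    (g : nat -> X -> X) (hg : finite_rearrangement f g) :
  topologically_mixing g.
Proof.
have [N gfE] := seq_comp_rearrangement _ _ _ hcomm hg.
move=> U V oU U0 oV V0; have [k [k0 kmix]] := hmix U V oU U0 oV V0.
exists (maxn N k); rewrite leq_max k0 orbT; split=> // n.
by rewrite geq_max => /andP[leNn lekn]; rewrite gfE//; exact: kmix.
Qed.
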